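(* Let $H$ be a finitely generated $\mathbb{Z}[t^{\pm1}]$-module, and let $n$ be a positive integer. (i) Any irreducible representation $\alpha:\mathbb{Z}\ltimes H\to\mathrm{GL}(n,\mathbb{C})$ is conjugate to $\alpha_{(z,\chi)}$ for a character $\chi:H\to\mathbb{C}^*$ of order $n$ and some $z\in\mathbb{C}^*$. (ii) If $\chi_1,\chi_2:H\to\mathbb{C}^*$ are characters of order $n$ and $z_1,z_2\in\mathbb{C}^*$, then $\alpha_{(z_1,\chi_1)}$ is conjugate to $\alpha_{(z_2,\chi_2)}$ if and only if $z_1=z_2$ and $\chi_1=t^k\chi_2$ for some integer $k$.
   Context: $\mathbb{Z}\ltimes H$ is the set $\mathbb{Z}\times H$ with group law $(j_1,h_1)(j_2,h_2)=(j_1+j_2,\,t^{j_2}h_1+h_2)$. A character of $H$ is a group homomorphism $\chi:H\to\mathbb{C}^*=\mathbb{C}\setminus\{0\}$; it has order $k$ if $k=\min\{\ell\ge1\mid \chi\text{ factors through }H/(t^\ell-1)\}$, where $H/(t^\ell-1)=H/(t^\ell-1)H$. The character $t^i\chi$ is defined by $(t^i\chi)(h)=\chi(t^ih)$. For $z\in\mathbb{C}^*$ and $\chi$ a character factoring through $H/(t^n-1)$, the representation $\alpha_{(z,\chi)}:\mathbb{Z}\ltimes H\to\mathrm{GL}(n,\mathbb{C})$ is defined by $$\alpha_{(z,\chi)}(j,h)=M_z^{\,j}\cdot\operatorname{diag}(\chi(h),\chi(th),\dots,\chi(t^{n-1}h)),$$ where $M_z$ is the $n\times n$ matrix with $M_ze_i=e_{i+1}$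 for $1\le i<n$ and $M_ze_n=z e_1$ (so $M_z=(z)$ if $n=1$). *)

(* Defs.v *)
From HB Require Import structures.
From mathcomp Require Import all_boot all_order all_algebra.
From mathcomp Require Import boolp.

Set Implicit Arguments.
Unset Strict Implicit.
Unset Printing Implicit Defensive.

Import GRing.Theory.
Local Open Scope ring_scope.
Local Open Scope quotient_scope.

(* Z[t, t^-1] is realized inside Frac(Z[t]) as the fractions p / t^n. *)
Definition laurent_pred : {pred {fraction {poly int}}} :=
  fun x => `[< exists (p : {poly int}) (n : nat),
                 x = FracField.tofrac p / FracField.tofrac 'X ^+ n >].

Lemma fracX_neq0 : FracField.tofrac ('X : {poly int}) != 0.
Proof. by rewrite tofrac_eq0 polyX_eq0. Qed.

Fact laurent_subring_closed : subring_closed laurent_pred.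
Proof.
have X0 k : FracField.tofrac ('X : {poly int}) ^+ k != 0.
  by rewrite expf_neq0 ?fracX_neq0.
split.
- by apply/asboolP; exists 1, 0%N; rewrite tofrac1 expr0 divr1.
- move=> _ _ /asboolP[p [n ->]] /asboolP[q [m ->]]; apply/asboolP.
  exists (p * 'X^m - q * 'X^n), (n + m)%N.
  by rewrite -mulNr addf_div // tofracB !tofracM !tofracXn mulNr exprD.
- move=> _ _ /asboolP[p [n ->]] /asboolP[q [m ->]]; apply/asboolP.
  by exists (p * q), (n + m)%N; rewrite mulf_div -tofracM -exprD.
Qed.

HB.instance Definition _ :=
  GRing.isSubringClosed.Build _ laurent_pred laurent_subring_closed.

Record laurent := Laurent {
  laurent_val :> {fraction {poly int}};
  _ : laurent_val \in laurent_pred }.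

HB.instance Definition _ := [isSub for laurent_val].
HB.instance Definition _ := [Choice of laurent by <:].
HB.instance Definition _ := [SubChoice_isSubComNzRing of laurent by <:].

Definition laurent_unit : {pred laurent} :=
  fun x => (val x != 0) && ((val x)^-1 \in laurent_pred).
Definition laurent_inv (x : laurent) : laurent := insubd x (val x)^-1.

Fact laurent_mulVx : {in laurent_unit, left_inverse 1 laurent_inv *%R}.
Proof.
move=> x /andP[x0 xV]; apply: val_inj.
by rewrite rmorphM rmorph1 /= val_insubd xV mulVf.
Qed.

Fact laurent_unitPl (x y : laurent) : y * x = 1 -> laurent_unit x.
Proof.
move=> /(congr1 val); rewrite rmorphM rmorph1 /= => yx.
have x0 : val x != 0.
  by apply/eqP => x0; move: yx; rewrite x0 mulr0 => /esym/eqP; rewrite oner_eq0.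
have -> : laurent_unit x = (val x != 0) && ((val x)^-1 \in laurent_pred) by [].
rewrite x0 /=; suff -> : (val x)^-1 = val y by apply: valP.
by apply: (mulIf x0); rewrite mulVf.
Qed.

Fact laurent_invr_out : {in [predC laurent_unit], laurent_inv =1 id}.
Proof.
move=> x; rewrite inE => /negbTE nU; apply: val_inj; rewrite val_insubd.
case: ifP => // xV; case: (eqVneq (val x) 0) => [->|x0]; first by rewrite invr0.
by move: nU; rewrite unfold_in x0 xV.
Qed.

HB.instance Definition _ := GRing.ComNzRing_hasMulInverse.Build laurent
  laurent_mulVx laurent_unitPl laurent_invr_out.

Fact laurentX_subproof : FracField.tofrac 'X \in laurent_pred.
Proof. by apply/asboolP; exists 'X, 0%N; rewrite expr0 divr1. Qed.

Definition laurentX : laurent := Laurent laurentX_subproof.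
Notation "''t'" := laurentX (at level 0) : ring_scope.

(* Needed for 't ^ k with k < 0 to be a genuine negative power. *)
Lemma laurentX_unit : 't \is a GRing.unit.
Proof.
rewrite unfold_in /= /laurent_unit fracX_neq0 /=.
by apply/asboolP; exists 1, 1%N; rewrite tofrac1 expr1 div1r.
Qed.

Definition finitely_generated (A : pzRingType) (V : lmodType A) : Prop :=
  exists s : seq V, forall v : V,
    exists c : 'I_(size s) -> A, v = \sum_(i < size s) c i *: s`_i.

Section SemidirectProduct.
Variable H : lmodType laurent.

Definition semidirect : Type := (int * H)%type.

HB.instance Definition _ := Choice.on semidirect.

Definition sd_one : semidirect := (0, 0).
Definition sd_mul (x y : semidirect) : semidirect :=
  (x.1 + y.1, 't ^ y.1 *: x.2 + y.2).
Definition sd_inv (x : semidirect) : semidirect :=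
  (- x.1, - ('t ^ (- x.1) *: x.2)).

Fact sd_mulA : associative sd_mul.
Proof.
case=> [j1 h1] [j2 h2] [j3 h3]; rewrite /sd_mul /= addrA; congr (_, _).
by rewrite scalerDr scalerA -exprzDr ?laurentX_unit // addrA [j3 + _]addrC.
Qed.

Fact sd_mul1 : left_id sd_one sd_mul.
Proof. by case=> [j h]; rewrite /sd_mul /= add0r scaler0 add0r. Qed.

Fact sd_mulr1 : right_id sd_one sd_mul.
Proof. by case=> [j h]; rewrite /sd_mul /= !addr0 expr0z scale1r. Qed.

Fact sd_mulV : left_inverse sd_one sd_inv sd_mul.
Proof.
case=> [j h]; rewrite /sd_mul /= addNr scalerN scalerA.
by rewrite -exprzDr ?laurentX_unit // subrr expr0z scale1r addNr.
Qed.

Fact sd_mulrV : right_inverse sd_one sd_inv sd_mul.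
Proof. by case=> [j h]; rewrite /sd_mul /= !subrr. Qed.

HB.instance Definition _ := isGroup.Build semidirect
  sd_mulA sd_mul1 sd_mulr1 sd_mulV sd_mulrV.

End SemidirectProduct.

Section Representations.
Variables (C : fieldType) (G : groupType) (n : nat).
Implicit Types rho : G -> 'M[C]_n.

Definition is_representation rho : Prop :=
  (forall g, rho g \in unitmx) /\ {morph rho : x y / (x * y)%g >-> x *m y}.

Definition irreducible rho : Prop :=
  (0 < n)%N /\
  forall V : {vspace 'cV[C]_n},
    (forall g v, v \in V -> rho g *m v \in V) -> V = 0%VS \/ V = fullv.

Definition conjugate rho1 rho2 : Prop :=
  exists2 P : 'M[C]_n, P \in unitmx & forall g, rho1 g = P *m rho2 g *m invmx P.

End Representations.

Definition is_character (C : fieldType) (A : zmodType) (chi : A -> C) : Prop :=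
  (forall a, chi a != 0) /\ {morph chi : a b / a + b >-> a * b}.

Section Characters.
Variables (C : fieldType) (H : lmodType laurent).
Implicit Types chi : H -> C.

Definition tl1_pred (l : nat) : {pred H} :=
  fun h => `[< exists g : H, h = ('t ^+ l - 1) *: g >].

Fact tl1_zmod_closed l : zmod_closed (tl1_pred l).
Proof.
split; first by apply/asboolP; exists 0; rewrite scaler0.
move=> _ _ /asboolP[x ->] /asboolP[y ->]; apply/asboolP.
by exists (x - y); rewrite scalerBr.
Qed.

HB.instance Definition _ l :=
  GRing.isZmodClosed.Build H (tl1_pred l) (tl1_zmod_closed l).

(* The quotient carries the additive group H / (t^l - 1) H; characters do not
   see the remaining module structure. *)
Notation tquot l := (Quotient.quot (tl1_pred l)).

Definition factors_through chi (l : nat) : Prop :=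
  exists2 chi' : tquot l -> C, is_character chi' &
    forall h : H, chi h = chi' (\pi_(tquot l) h).

Definition has_order chi (k : nat) : Prop :=
  [/\ (1 <= k)%N, factors_through chi k &
      forall l : nat, (1 <= l)%N -> factors_through chi l -> (k <= l)%N].

Definition tshift (k : int) chi : H -> C := fun h => chi ('t ^ k *: h).

End Characters.

(* Square matrices have size n.+1 since only these carry the unit ring structure
   giving meaning to the integer power of M_z. *)
Section AlphaRepresentation.
Variables (C : fieldType) (H : lmodType laurent) (n : nat).

(* Columns and rows are indexed from 0: e_j |-> e_(j+1) for j < n, and
   e_n |-> z e_0. *)
Definition Mz (z : C) : 'M[C]_n.+1 :=
  \matrix_(i, j) if (j < n)%N then ((i : nat) == j.+1)%:R
                 else if (i : nat) == 0%N then z else 0.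

Definition alpha_rep (z : C) (chi : H -> C) (g : semidirect H) : 'M[C]_n.+1 :=
  Mz z ^ g.1 *m diag_mx (\row_(i < n.+1) chi ('t ^+ i *: g.2)).

End AlphaRepresentation.

(* Main.v *)
Require Import Defs.
From mathcomp Require Import all_boot all_order all_algebra.
From mathcomp Require Import boolp reals.
From mathcomp Require Import complex.

Set Implicit Arguments.
Unset Strict Implicit.
Unset Printing Implicit Defensive.

Import GRing.Theory.
Local Open Scope ring_scope.
Local Open Scope quotient_scope.

(* Transposing alpha turns the commuting matrices alpha(0,h) into operators on
   row vectors, where MathComp's subspace theory lives.  They have a common
   eigenvector v, with character chi; writing X for the transpose of alpha(1,0),
   v X^i is a common eigenvector with character t^i chi, and the v X^i span by
   irreducibility.  Expanding v X^n on v, v X, ..., v X^(n-1) yields a period of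
   chi; if m is the least one, X^m commutes with everything, hence is a scalar z
   by Schur, so v, ..., v X^(m-1) already span and m = n: in this basis alpha is
   alpha_(z,chi).  For (ii), z is recovered from M_z^n = z, and chi up to shift
   from the simultaneous eigenvalues of the alpha(0,h). *)

(** * Characters, and integer powers in twisted commutation relations *)

Lemma character0 (C : fieldType) (A : zmodType) (chi : A -> C) :
  is_character chi -> chi 0 = 1.
Proof.
case=> chi0 chiD; apply: (mulIf (chi0 0)).
by rewrite -chiD addr0 mul1r.
Qed.

Lemma character_opp (C : fieldType) (A : zmodType) (chi : A -> C) a :
  is_character chi -> chi (- a) = (chi a)^-1.
Proof.
move=> chiP; have [chi0 chiD] := chiP; apply: (mulIf (chi0 a)).
by rewrite -chiD addNr character0 // mulVf.
Qed.

(** Turns the order of [chi] into its least period under ['t]. Periodicity makes [chi] trivial on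
    (t^l - 1)H, so [chi \o repr] does not depend on the chosen representatives. *)
Lemma factors_throughP (C : fieldType) (H : lmodType laurent) (chi : H -> C)
    (l : nat) :
  is_character chi ->
  factors_through chi l <-> forall h, chi ('t ^+ l *: h) = chi h.
Proof.
move=> chiP; split=> [[chi' _ chi'E] h|chil].
  rewrite !chi'E; congr chi'; apply/eqP; rewrite -Quotient.idealrBE.
  by apply/asboolP; exists h; rewrite scalerBl scale1r.
have chi_pi x y : x = y %[mod Quotient.quot (tl1_pred (H := H) l)] ->
    chi x = chi y.
  move=> /eqP; rewrite -Quotient.idealrBE => /asboolP[g xyE].
  rewrite -[x](subrK y) xyE scalerBl scale1r.
  have [chi0 chiD] := chiP.
  by rewrite !chiD character_opp // chil mulfV // mul1r.
exists (chi \o repr); last by move=> h /=; apply: chi_pi; rewrite reprK.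
have [chi0 chiD] := chiP; split=> [a|a b] /=; first exact: chi0.
by rewrite -chiD; apply: chi_pi; rewrite raddfD /= !reprK.
Qed.

Lemma intertwine_exprz (A : unitRingType) (x y p : A) (j : int) :
  x \is a GRing.unit -> y \is a GRing.unit -> x * p = p * y ->
  x ^ j * p = p * y ^ j.
Proof.
move=> xU yU xp.
have natE k : x ^+ k * p = p * y ^+ k.
  elim: k => [|k IHk]; first by rewrite !expr0 mul1r mulr1.
  by rewrite exprS -mulrA IHk mulrA xp -mulrA -exprS.
case: j => k; first exact: natE.
rewrite NegzE -!exprnN; apply: (mulrI (unitrX k.+1 xU)).
rewrite mulrA divrr ?unitrX // mul1r mulrA natE -mulrA divrr ?unitrX //.
by rewrite mulr1.
Qed.

Lemma twist_exprz (H : lmodType laurent) (A : unitRingType) (d : H -> A)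
    (m : A) (k : int) h :
  m \is a GRing.unit -> (forall h, d h * m = m * d ('t *: h)) ->
  d h * m ^ k = m ^ k * d ('t ^ k *: h).
Proof.
move=> mU dm.
have natE i h' : d h' * m ^+ i = m ^+ i * d ('t ^+ i *: h').
  elim: i h' => [|i IHi] h'; first by rewrite !expr0 mul1r mulr1 scale1r.
  by rewrite exprS mulrA dm -mulrA IHi mulrA scalerA -exprSr.
case: k => i; first exact: natE.
(* Multiplying by [m ^+ i.+1] on both sides turns the negative case into [natE] at a translate of
   [h]. *)
rewrite NegzE -!exprnN; apply: (mulrI (unitrX i.+1 mU)).
apply: (mulIr (unitrX i.+1 mU)).
rewrite -mulrA -[d h * _ * _]mulrA mulVr ?unitrX // mulr1.
rewrite [in RHS]mulrA divrr ?unitrX // mul1r natE.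
by rewrite scalerA divrr ?scale1r // unitrX // laurentX_unit.
Qed.

(** * The representations [alpha_rep] and their conjugacy *)

Section Alpha.
Variables (C : fieldType) (H : lmodType laurent) (n : nat).
Implicit Types (z : C) (chi : H -> C).

Let D chi h : 'M[C]_n.+1 := diag_mx (\row_(i < n.+1) chi ('t ^+ i *: h)).

Lemma mul_Mz_lt z (B : 'M[C]_n.+1) i (j : 'I_n.+1) (ltjn : (j.+1 < n.+1)%N) :
  (B *m Mz n z) i j = B i (Ordinal ltjn).
Proof.
rewrite !mxE (bigD1 (Ordinal ltjn)) //= !mxE -ltnS ltjn eqxx mulr1.
rewrite big1 ?addr0 // => l; rewrite -val_eqE !mxE -ltnS ltjn /= => /negbTE->.
by rewrite mulr0.
Qed.

Lemma mul_Mz_max z (B : 'M[C]_n.+1) i (j : 'I_n.+1) :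
  (j.+1 = n.+1)%N -> (B *m Mz n z) i j = B i ord0 * z.
Proof.
move=> [jn]; rewrite !mxE (bigD1 ord0) //= !mxE jn ltnn eqxx.
rewrite big1 ?addr0 // => l; rewrite -val_eqE !mxE jn ltnn /= => /negbTE->.
by rewrite mulr0.
Qed.

Lemma Mz_order z : Mz n z ^+ n.+1 = z%:M.
Proof.
have entry k (i j : 'I_n.+1) : (j + k < n.+1)%N ->
    (Mz n z ^+ k) i j = (i == (j + k)%N :> nat)%:R.
  elim: k j => [|k IHk] j; first by rewrite addn0 expr0 !mxE.
  rewrite addnS => ltjk; have ltj : (j.+1 < n.+1)%N.
    by apply: leq_ltn_trans ltjk; rewrite ltnS leq_addr.
  by rewrite exprSr -mulmxE mul_Mz_lt IHk /= ?addSn.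
(* Once the shifted index passes n it wraps around, and for k up to n+1 it does so exactly once,
   picking up a single factor z. *)
have wrap k (i j : 'I_n.+1) : (n < j + k)%N -> (k <= n.+1)%N ->
    (Mz n z ^+ k) i j = z *+ (i + n.+1 == j + k)%N.
  elim: k j => [|k IHk] j.
    by rewrite addn0 ltnNge -ltnS ltn_ord.
  rewrite addnS ltnS => ltjk ltk; rewrite exprSr -mulmxE.
  have := ltn_ord j; rewrite leq_eqVlt => /orP[/eqP jn|ltj].
    rewrite mul_Mz_max // entry //= add0n -addSn jn [(n.+1 + k)%N]addnC.
    by rewrite eqn_add2r mulr_natl.
  by rewrite mul_Mz_lt IHk /= ?addSn // ltnW.
apply/matrixP => i j; rewrite wrap //; last by rewrite ltn_addl.
by rewrite eqn_add2r mxE.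
Qed.

Lemma Mz_unit z : z != 0 -> Mz n z \is a GRing.unit.
Proof.
move=> z0; rewrite -(unitrX_pos _ (ltn0Sn n)) Mz_order.
by rewrite -[_ \is a _]/(z%:M \in unitmx) unitmxE det_scalar unitfE expf_neq0.
Qed.

(** Both sides shift the diagonal by one place; periodicity enters only in the last column, where
    t^(n+1) must agree with t^0. *)
Lemma diag_Mz z chi h : (forall h, chi ('t ^+ n.+1 *: h) = chi h) ->
  D chi h * Mz n z = Mz n z * D chi ('t *: h).
Proof.
move=> chin; apply/matrixP => i j.
rewrite -!mulmxE mul_mx_diag mxE [in RHS]mxE.
have := ltn_ord j; rewrite leq_eqVlt => /orP[/eqP jn|ltj].
  rewrite mul_Mz_max // !mxE; case: jn => jn; rewrite jn ltnn.
  rewrite scalerA -exprSr chin.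
  have [->|i0] := eqVneq i ord0; last first.
    by rewrite -val_eqE /= in i0; rewrite (negbTE i0) mulr0n !mul0r.
  by rewrite eqxx mulr1n expr0 scale1r mulrC.
rewrite mul_Mz_lt !mxE -ltnS ltj -val_eqE /= scalerA -exprSr.
by case: eqP => [->|_]; rewrite ?mul1r ?mulr1n ?mulr0n ?mul0r.
Qed.

Lemma alpha_rep_gen z chi :
  is_character chi -> alpha_rep n z chi (1, 0) = Mz n z.
Proof.
move=> chiP; rewrite /alpha_rep /= expr1z -[RHS]mulmx1; congr (_ *m _).
by apply/matrixP => i j; rewrite !mxE scaler0 character0.
Qed.

Lemma alpha_rep_tors z chi h : alpha_rep n z chi (0, h) = D chi h.
Proof. by rewrite /alpha_rep /= expr0z mul1mx. Qed.

Lemma alpha_conjP chi1 chi2 z1 z2 :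
  is_character chi1 -> has_order chi1 n.+1 ->
  is_character chi2 -> has_order chi2 n.+1 ->
  z1 != 0 -> z2 != 0 ->
  (conjugate (alpha_rep n z1 chi1) (alpha_rep n z2 chi2) <->
   z1 = z2 /\ exists k : int, chi1 =1 tshift k chi2).
Proof.
move=> chi1P [_ _ _] chi2P [_ /(factors_throughP _ chi2P) chi2n _] z10 z20.
split=> [[P PU PE]|[<- [k chi1E]]].
  have PV Q R : Q = P *m R *m invmx P -> Q *m P = P *m R.
    by move=> ->; rewrite mulmxKV.
  have := PE (1, 0); rewrite !alpha_rep_gen // => /PV MP.
  split.
    have : Mz n z1 ^+ n.+1 * P = P * Mz n z2 ^+ n.+1.
      by apply: (@intertwine_exprz _ _ _ _ n.+1); rewrite ?Mz_unit.
    rewrite !Mz_order -!mulmxE scalar_mxC => /(can_inj (mulmxK PU)).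
    by move=> /matrixP/(_ ord0 ord0); rewrite !mxE eqxx.
  (* The first row of the invertible [P] has a nonzero entry, in column j say. Comparing the (0, j)
     entries of D1 P = P D2 gives chi1(h) = chi2(t^j h), so j is the shift. *)
  have /existsP[j Pj] : [exists j, P ord0 j != 0].
    apply: contraLR PU => /existsPn P0; rewrite unitmxE (expand_det_row _ ord0).
    by rewrite big1 ?unitr0 // => j _; rewrite (eqP (negPn (P0 j))) mul0r.
  exists j => h; have := PE (0, h); rewrite !alpha_rep_tors => /PV.
  move/matrixP/(_ ord0 j); rewrite mul_mx_diag mul_diag_mx !mxE expr0 scale1r.
  by rewrite mulrC => /(mulfI Pj).
have MU := Mz_unit z10; set M := Mz n z1 in MU.
have MkU : M ^ k \is a GRing.unit by rewrite unitrXz.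
(* Moving M^k leftwards across D2(h) replaces it by D2(t^k h) = D1(h), while the powers of M
   cancel. *)
exists (M ^ (- k)); first by rewrite -exprz_inv unitrXz // unitrV.
case=> j h; rewrite /alpha_rep /= -/M -/(D chi1 h) -/(D chi2 h) !mulmxE.
have -> : invmx (M ^ (- k)) = M ^ k.
  by rewrite -[LHS]/((M ^ (- k))^-1) -invr_expz invrK.
have -> : D chi1 h = D chi2 ('t ^ k *: h).
  apply/matrixP => i l; rewrite !mxE chi1E /tshift !scalerA.
  by rewrite mulrC.
rewrite -!mulrA (twist_exprz _ _ MU); last first.
  by move=> h'; exact: diag_Mz.
by rewrite !mulrA -!exprzDr // [_ + k]addrC addrA subrr add0r.
Qed.

End Alpha.

(** * Common eigenvectors and stable row spaces *)

(** Induction on the dimension, so the family may be infinite. A non-scalar member has a proper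
    eigenspace, stable under all the others, to which the family is restricted; if all are scalar,
    any nonzero vector works. *)
Lemma common_eigenvector_family (C : numClosedFieldType) (I : Type) n
    (B : I -> 'M[C]_n) :
  (0 < n)%N -> (forall i j, comm_mx (B i) (B j)) ->
  exists2 v : 'rV_n, v != 0 & forall i, stablemx v (B i).
Proof.
have [k] := ubnP n; elim: k n B => // k IHk n B; rewrite ltnS => lenk n_gt0 BC.
have [[i Bi]|Bscal] := pselect (exists i, ~~ is_scalar_mx (B i)); last first.
  exists (const_mx 1).
    apply/eqP=> /rowP/(_ (Ordinal n_gt0)); rewrite !mxE => /eqP.
    by rewrite oner_eq0.
  move=> i; suff /is_scalar_mxP[a ->] : is_scalar_mx (B i) by exact: stablemxC.
  by apply: contra_notT Bscal => Bi; exists i.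
have [a a_eigen] := eigenvalue_closed (B i) n_gt0.
set V := eigenspace (B i) a in a_eigen *.
have VB j : stablemx V (B j) by apply: comm_mx_stable_eigenspace.
have ltVn : (\rank V < n)%N.
  rewrite ltn_neqAle rank_leq_row andbT; apply: contra Bi => Vn.
  apply/is_scalar_mxP; exists a.
  have /eigenspaceP : (1%:M <= V)%MS by rewrite sub1mx.
  by rewrite mul1mx scalemx1.
have [||j l|v v0 vB] := IHk _ (fun j => restrictmx V (B j)).
- exact: leq_trans lenk.
- by rewrite lt0n mxrank_eq0.
- by rewrite /comm_mx -!conjmxM ?inE ?stablemx_row_base // BC.
exists (v *m row_base V); first by rewrite mulmx_free_eq0 ?row_base_free.
by move=> j; rewrite -stablemx_restrict.
Qed.

(** An invertible [A] preserves rank, so the inclusion of U A in U is an equality. *)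
Lemma stablemx_inv (F : fieldType) m n (U : 'M[F]_(m, n)) (A : 'M[F]_n) :
  A \in unitmx -> stablemx U A -> stablemx U (invmx A).
Proof.
move=> AU UA; rewrite -(submxMfree _ _ (C := A)) ?row_free_unit // mulmxKV //.
rewrite -(mxrank_leqif_sup UA).2.
by rewrite mxrankMfree ?row_free_unit.
Qed.

(** Carries irreducibility from subspaces of column vectors to row spaces of matrices: the image of
    [f] consists of the transposes of the vectors in the row space of [U]. *)
Lemma irreducible_full (C : fieldType) (G : groupType) n m
    (rho : G -> 'M[C]_n) (U : 'M[C]_(m, n)) :
  irreducible rho -> U != 0 -> (forall g, stablemx U (rho g)^T) -> row_full U.
Proof.
case=> n_gt0 irr U0 Ustab.
pose f := linfun (trmx \o mulmxr U : 'rV[C]_m -> 'cV[C]_n).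
have memP v : reflect (exists x, v = (x *m U)^T) (v \in limg f).
  by apply: (iffP memv_imgP) => [[x _ ->]|[x ->]]; exists x;
    rewrite ?lfunE ?memvf.
have [g v /memP[x ->]|img0|imgT] := irr (limg f).
- apply/memP; have /submxP[y yE] : (x *m U *m (rho g)^T <= U)%MS.
    by apply: submx_trans (Ustab g); rewrite -mulmxA submxMl.
  by exists y; rewrite -yE [in RHS]trmx_mul trmxK.
- case/negP: U0; apply/eqP/row_matrixP => i; rewrite row0 rowE.
  have : (delta_mx 0 i *m U)^T \in limg f by apply/memP; eexists.
  by rewrite img0 memv0 => /eqP/(congr1 trmx); rewrite trmxK trmx0.
- rewrite -sub1mx; apply/row_subP => i.
  have /memP[x /(congr1 trmx)] : (row i 1%:M : 'rV[C]_n)^T \in limg f.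
    by rewrite imgT memvf.
  by rewrite !trmxK => ->; rewrite submxMl.
Qed.

(** * Krylov spaces *)

Section Krylov.
Variables (F : fieldType) (n : nat).
Implicit Types (v : 'rV[F]_n.+1) (X : 'M[F]_n.+1).

Definition krylov v X k : 'M[F]_(k, n.+1) := \matrix_(i < k) (v *m X ^+ i).

Lemma krylov_stable v X k : (v *m X ^+ k <= krylov v X k)%MS ->
  stablemx (krylov v X k) X.
Proof.
move=> vXk; apply/row_subP => i; rewrite row_mul rowK -mulmxA mulmxE -exprSr.
have := ltn_ord i; rewrite leq_eqVlt => /orP[/eqP -> //|lti].
by have := row_sub (Ordinal lti) (krylov v X k); rewrite rowK.
Qed.

Lemma krylov_Cayley_Hamilton v X : (v *m X ^+ n.+1 <= krylov v X n.+1)%MS.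
Proof.
(* By Cayley-Hamilton the remainder takes the same value at X, and its degree is at most n. *)
pose p := 'X^(n.+1) %% char_poly X.
have -> : X ^+ n.+1 = horner_mx X p.
  rewrite -[LHS](congr1 (@GRing.exp _ ^~ n.+1) (horner_mx_X X)) -rmorphXn /=.
  rewrite [in LHS](divp_eq 'X^(n.+1) (char_poly X)) rmorphD rmorphM /=.
  by rewrite Cayley_Hamilton mulr0 add0r.
have szp : (size p <= n.+1)%N.
  have ltp : (size p < size (char_poly X))%N.
    by rewrite ltn_modp monic_neq0 ?char_poly_monic.
  by rewrite size_char_poly in ltp.
rewrite -[p]coefK poly_def rmorph_sum mulmx_sumr.
apply: summx_sub => i _; rewrite /= horner_mxZ /= rmorphXn /= horner_mx_X.
rewrite -scalemxAr.
have := row_sub (widen_ord szp i) (krylov v X n.+1).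
by rewrite rowK /=; apply: scalemx_sub.
Qed.

End Krylov.

Lemma sd_mulE (H : lmodType laurent) j k (h g : H) :
  (((j, h) : semidirect H) * ((k, g) : semidirect H))%g =
  (j + k, 't ^ k *: h + g).
Proof. by []. Qed.

(** * Normal form of an irreducible representation *)

Section IrreducibleRepresentation.
Variables (C : numClosedFieldType) (H : lmodType laurent) (n : nat).
Variable rho : semidirect H -> 'M[C]_n.+1.
Hypotheses (rhoP : is_representation rho) (irr : irreducible rho).

Let T := rho (1, 0).
Let X := T^T.
Let B h := (rho (0, h))^T.

Lemma rep1 : rho 1%g = 1.
Proof.
have [rhoU rhoM] := rhoP; apply: (mulrI (rhoU 1%g)).
by rewrite -mulmxE -rhoM mul1g mulmxE mulr1.
Qed.

Lemma rep_gen (j : int) : rho (j, 0) = T ^ j.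
Proof.
have [rhoU rhoM] := rhoP.
have natE k : rho (k%:Z, 0) = T ^+ k.
  elim: k => [|k IHk]; first by rewrite expr0 -rep1.
  rewrite exprSr -IHk -mulmxE -rhoM; congr rho.
  by rewrite sd_mulE scaler0 addr0 -addn1.
case: j => k; first exact: natE.
rewrite NegzE -exprnN; apply: (mulIr (unitrX k.+1 (rhoU (1, 0)))).
rewrite mulVr ?unitrX ?rhoU // -natE -rep1 -mulmxE -rhoM; congr rho.
by rewrite sd_mulE scaler0 addr0 addNr.
Qed.

Lemma rep_split j h : rho (j, h) = T ^ j *m rho (0, h).
Proof.
have [_ rhoM] := rhoP; rewrite -rep_gen -rhoM; congr rho.
by rewrite sd_mulE scaler0 add0r addr0.
Qed.

Lemma rep_gen_unit : T \is a GRing.unit.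
Proof. by have [rhoU _] := rhoP; apply: rhoU. Qed.

(** Transpose of the group relation (0,h)(1,0) = (1,0)(0,th). *)
Lemma tors_twist h : X *m B h = B ('t *: h) *m X.
Proof.
have [_ rhoM] := rhoP; rewrite -!trmx_mul -!rhoM; congr (rho _)^T.
by rewrite !sd_mulE scaler0 expr1z !addr0 !add0r.
Qed.

Lemma tors_twist_exp k h : X ^+ k *m B h = B ('t ^+ k *: h) *m X ^+ k.
Proof.
elim: k h => [|k IHk] h; first by rewrite !expr0 scale1r mulmx1 mul1mx.
by rewrite exprSr -mulmxA tors_twist mulmxA IHk -mulmxA scalerA exprSr.
Qed.

Lemma torsD h g : B (h + g) = B h *m B g.
Proof.
have [_ rhoM] := rhoP; rewrite -trmx_mul -rhoM addrC; congr (rho _)^T.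
by rewrite sd_mulE expr0z scale1r.
Qed.

Lemma tors_unit h : B h \in unitmx.
Proof. by have [rhoU _] := rhoP; rewrite unitmx_tr. Qed.

(** Stability need only be checked on generators: (j,h) = (1,0)^j (0,h), and negative j is handled
    by [stablemx_inv]. *)
Lemma stable_full m (U : 'M[C]_(m, n.+1)) :
  U != 0 -> stablemx U X -> (forall h, stablemx U (B h)) -> row_full U.
Proof.
move=> U0 UX UB; apply: (irreducible_full irr U0) => -[j h].
rewrite rep_split trmx_mul stablemxM ?UB //.
have natS k : stablemx U (T ^+ k)^T.
  elim: k => [|k IHk]; first by rewrite expr0 trmx1 mulmx1.
  by rewrite exprSr -mulmxE trmx_mul stablemxM.
case: j => k; first exact: natS.
rewrite NegzE -exprnN -[_^-1]/(invmx _) trmx_inv stablemx_inv //.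
by rewrite unitmx_tr; apply: (unitrX k.+1 rep_gen_unit).
Qed.

(** An eigenspace of [A] is nonzero and stable, hence everything. *)
Lemma Schur_scalar (A : 'M[C]_n.+1) :
  comm_mx A X -> (forall h, comm_mx A (B h)) -> exists z, A = z%:M.
Proof.
move=> AX AB; have [z zA] := eigenvalue_closed A (ltn0Sn n).
exists z; have full : row_full (eigenspace A z).
  by apply: stable_full => // *; apply: comm_mx_stable_eigenspace.
have /eigenspaceP : (1%:M <= eigenspace A z)%MS by rewrite sub1mx.
by rewrite mul1mx scalemx1.
Qed.

Lemma irreducible_alpha_rep : exists (z : C) (chi : H -> C),
  [/\ z != 0, is_character chi, has_order chi n.+1 &
      conjugate rho (alpha_rep n z chi)].
Proof.
have [v v0 vB] : exists2 v : 'rV_n.+1, v != 0 & forall h, stablemx v (B h).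
  by apply: common_eigenvector_family => // h g; rewrite /comm_mx -!torsD addrC.
have /choice[chi chiE] h : exists a, v *m B h = a *: v.
  by have /sub_rVP[a aE] := vB h; exists a.
have scale_inj a b : a *: v = b *: v -> a = b.
  move/eqP; rewrite -subr_eq0 -scalerBl scaler_eq0 (negPf v0) orbF subr_eq0.
  by move/eqP.
have chiP : is_character chi.
  split=> [h|h g].
    apply/eqP => h0; case/negP: v0; apply/eqP.
    by rewrite -[v](mulmxK (tors_unit h)) chiE h0 scale0r mul0mx.
  apply: scale_inj.
  by rewrite -chiE torsD mulmxA chiE -scalemxAl chiE scalerA.
have krylovB k h (i : 'I_k) :
    row i (krylov v X k) *m B h = chi ('t ^+ i *: h) *: row i (krylov v X k).
  by rewrite rowK -mulmxA tors_twist_exp mulmxA chiE scalemxAl.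
(* As soon as v X^k depends on the earlier vectors, these already span. *)
have krylov_full k : (0 < k)%N -> (v *m X ^+ k <= krylov v X k)%MS ->
    row_full (krylov v X k).
  move=> k_gt0 vXk; apply: stable_full.
  - apply: contra v0 => /eqP/row_matrixP/(_ (Ordinal k_gt0)).
    by rewrite rowK row0 expr0 mulmx1 => ->.
  - exact: krylov_stable.
  - move=> h; apply/row_subP => i.
    by rewrite row_mul krylovB scalemx_sub ?row_sub.
have KU : krylov v X n.+1 \in unitmx.
  by rewrite -row_full_unit krylov_full // krylov_Cayley_Hamilton.
set K := krylov v X n.+1 in KU *.
have KB h : K *m B h = diag_mx (\row_(l < n.+1) chi ('t ^+ l *: h)) *m K.
  apply/row_matrixP => l.
  by rewrite !row_mul krylovB row_diag_mx -scalemxAl -rowE mxE.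
have XU k : X ^+ k \in unitmx.
  by apply: (@unitrX _ X); rewrite -[_ \is a _]/(X \in unitmx) unitmx_tr;
    apply: rep_gen_unit.
pose per m := (0 < m)%N && `[< forall h, chi ('t ^+ m *: h) = chi h >].
have [l len per_l] : exists2 l, (l <= n.+1)%N & per l.
  have /submxP[c cE] := krylov_Cayley_Hamilton v X; rewrite -/K in cE.
  have /rV0Pn[i ci] : c != 0.
    apply: contra v0 => /eqP c0; rewrite c0 mul0mx in cE.
    by rewrite -[v](mulmxK (XU n.+1)) cE mul0mx.
  (* Apply [B h] to v X^(n+1) = c K in two ways: as an eigenvector, and row by row on K. Coordinate
     i, where c is nonzero, equates the two eigenvalues. *)
  have chiNi h : chi ('t ^+ n.+1 *: h) = chi ('t ^+ i *: h).
    have : chi ('t ^+ n.+1 *: h) *: (c *m K) = c *m K *m B h.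
      by rewrite -cE -mulmxA tors_twist_exp mulmxA chiE scalemxAl.
    rewrite -mulmxA KB mulmxA scalemxAl => /(congr1 (mulmx^~ (invmx K))).
    rewrite !mulmxK // => /rowP/(_ i).
    by rewrite mul_mx_diag !mxE mulrC => /(mulfI ci).
  exists (n.+1 - i)%N; first exact: leq_subr.
  rewrite /per subn_gt0 ltn_ord; apply/asboolP => h.
  have tU := unitrX i laurentX_unit.
  (* Writing h = t^i (t^-i h) cancels the common shift, leaving the period n+1-i, positive as i <=
     n. *)
  rewrite -[h in RHS]scale1r -(mulrV tU) -scalerA -chiNi scalerA.
  have -> : 't ^+ n.+1 = 't ^+ (n.+1 - i) * 't ^+ i.
    by rewrite -exprD subnK // ltnW.
  by rewrite mulrK.
pose m := ex_minn (ex_intro per l per_l).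
have [m_gt0 chim min_m] : [/\ (0 < m)%N, forall h, chi ('t ^+ m *: h) = chi h &
    forall k, per k -> (m <= k)%N].
  by rewrite /m; case: ex_minnP => k /andP[k0 /asboolP chik] kmin.
have [z Xm] : exists z, X ^+ m = z%:M.
  apply: Schur_scalar => [|h]; first exact/esym/(@commrX _ X X m).
  (* It remains to see B(t^m h) = B(h): in the basis K both are diagonal, with equal entries since m
     is a period. *)
  rewrite /comm_mx tors_twist_exp; congr (_ *m _).
  apply: (can_inj (mulKmx KU)); apply/row_matrixP => i.
  rewrite !row_mul !krylovB; congr (_ *: _).
  by rewrite scalerA mulrC -scalerA chim.
have mE : m = n.+1.
  apply/eqP; rewrite eqn_leq (leq_trans (min_m _ per_l)) //=.
  (* X^m = z puts v X^m on the line of v, so m vectors span a space of dimension n+1. *)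
  have: row_full (krylov v X m).
    apply: krylov_full => //; rewrite Xm mul_mx_scalar scalemx_sub //.
    have := row_sub (Ordinal m_gt0) (krylov v X m).
    by rewrite rowK expr0 mulmx1.
  by rewrite /row_full => /eqP <-; apply: rank_leq_row.
rewrite mE in Xm chim min_m.
have z0 : z != 0.
  by have := XU n.+1; rewrite Xm unitmxE det_scalar unitfE expf_eq0.
exists z, chi; split=> //.
  split=> // [|k k_gt0 /(factors_throughP _ chiP) chik].
    exact/(factors_throughP _ chiP).
  by apply: min_m; rewrite /per k_gt0; apply/asboolP.
(* The columns of [K^T] are the transposes of the v X^j: [T] sends each to the next, and the last to
   z times the first because X^(n+1) = z. *)
exists K^T; first by rewrite unitmx_tr.
have PU : K^T \in unitmx by rewrite unitmx_tr.
have TK : T * K^T = K^T * Mz n z.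
  apply/matrixP => i j; rewrite -!mulmxE.
  have -> : (T *m K^T) i j = (v *m X ^+ j.+1) 0 i.
    have rowKj : v *m X ^+ j = row j K by rewrite rowK.
    by rewrite exprSr -mulmxE mulmxA rowKj -row_mul -[T]trmxK -trmx_mul !mxE.
  have := ltn_ord j; rewrite leq_eqVlt => /orP[/eqP jn|ltj].
    by rewrite mul_Mz_max // jn Xm mul_mx_scalar 3!mxE expr0 mulmx1 mulrC.
  by rewrite mul_Mz_lt !mxE.
have DK h : rho (0, h) *m K^T = K^T *m alpha_rep n z chi (0, h).
  by apply: trmx_inj; rewrite alpha_rep_tors !trmx_mul trmxK tr_diag_mx -KB.
case=> j h; apply: (can_inj (mulmxK PU)).
rewrite mulmxKV // rep_split -mulmxA DK mulmxA mulmxE.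
rewrite (intertwine_exprz _ rep_gen_unit (Mz_unit n z0) TK).
by rewrite /alpha_rep /= expr0z mul1mx -mulmxE mulmxA.
Qed.

End IrreducibleRepresentation.

Theorem theorem2p3 (R : realType) (H : lmodType laurent) (n : nat)
    (fgH : finitely_generated H) :
  (forall alpha : semidirect H -> 'M[R[i]]_n.+1,
     is_representation alpha -> irreducible alpha ->
     exists (z : R[i]) (chi : H -> R[i]),
       [/\ z != 0, is_character chi, has_order chi n.+1 &
           conjugate alpha (alpha_rep n z chi)])
  /\
  (forall (chi1 chi2 : H -> R[i]) (z1 z2 : R[i]),
     is_character chi1 -> has_order chi1 n.+1 ->
     is_character chi2 -> has_order chi2 n.+1 ->
     z1 != 0 -> z2 != 0 ->
     (conjugate (alpha_rep n z1 chi1) (alpha_rep n z2 chi2) <->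
      z1 = z2 /\ exists k : int, chi1 =1 tshift k chi2)).
Proof.
split; first exact: irreducible_alpha_rep.
exact: alpha_conjP.
Qed.
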